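(* In the semi-discrete solid wall setting described in the context, the interior penalty term $$\mathcal{M}^{(B,V)}=L\,\big(w-w^{(B,V)}\big),\qquad L=-\beta\,\frac{C_{1,1}(v)+C_{1,1}(v^{(B,V)})}{2},\quad \beta>0,$$ added to the boundary penalty on the conserved variables at each node of the wall face $x_1=0$, is entropy dissipative; that is, its point-wise contribution $w^\top\mathcal{M}^{(B,V)}=w^\top L\,(w-w^{(B,V)})$ to the time rate of change of the entropy function is non-positive.
   Context: Primitive variables at a wall node: $v=(\rho,\mathcal{U}_1,\mathcal{U}_2,\mathcal{U}_3,\mathcal{T})^\top$ with $\rho>0$, $\mathcal{T}>0$. Wall velocity $(0,\mathcal{U}_2^{wall},\mathcal{U}_3^{wall})$. Boundary state $$v^{(B,V)}=(\rho,\,-\mathcal{U}_1,\,-\mathcal{U}_2+2\mathcal{U}_2^{wall},\,-\mathcal{U}_3+2\mathcal{U}_3^{wall},\,\mathcal{T})^\top.$$ Constants $R>0$, $c_{\mathcal P}>R$, $\gamma=c_{\mathcal P}/(c_{\mathcal P}-R)$, $\rho_\infty,\mathcal{T}_\infty>0$; $s=\frac{R}{\gamma-1}\log(\mathcal{T}/\mathcal{T}_\infty)-R\log(\rho/\rho_\infty)$. Entropy variables $$W(v)=\Big(c_{\mathcal P}-s-\tfrac{\mathcal{U}^\top\mathcal{U}}{2\mathcal{T}},\ \tfrac{\mathcal{U}_1}{\mathcal{T}},\ \tfrac{\mathcal{U}_2}{\mathcal{T}},\ \tfrac{\mathcal{U}_3}{\mathcal{T}},\ -\tfrac1{\mathcal{T}}\Big)^\top,\qquad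 w=W(v),\quad w^{(B,V)}=W(v^{(B,V)}).$$ With viscosity $\mu=\mu(\mathcal{T})>0$ and conductivity $\kappa=\kappa(\mathcal{T})>0$, the symmetric positive semi-definite viscous coefficient matrix in the wall-normal direction is $$C_{1,1}(v)=\begin{pmatrix}0&0&0&0&0\\0&\tfrac43\mathcal{T}\mu&0&0&\tfrac43\mathcal{T}\mu\,\mathcal{U}_1\\0&0&\mathcal{T}\mu&0&\mathcal{T}\mu\,\mathcal{U}_2\\0&0&0&\mathcal{T}\mu&\mathcal{T}\mu\,\mathcal{U}_3\\0&\tfrac43\mathcal{T}\mu\,\mathcal{U}_1&\mathcal{T}\mu\,\mathcal{U}_2&\mathcal{T}\mu\,\mathcal{U}_3&\mathcal{T}^2\kappa+\tfrac13\mathcal{T}\mu(4\mathcal{U}_1^2+3\mathcal{U}_2^2+3\mathcal{U}_3^2)\end{pmatrix}.$$ Setting: in a diagonal-norm summation-by-parts semi-discretization of the compressible Navier--Stokes equations, contracting the discrete evolution equation with $w^\top\mathsf{P}$ (where $\mathsf{P}$ is the positive diagonal norm matrix) shows that a boundary penalty $\mathcal{M}$ added at the wall nodes contributes $\sum_a\mathsf{P}_a\,w_a^\top\mathcal{M}_a$ to the time derivative of the discretely integrated entropy function $\mathcal{S}=-\rho s$, where $\mathsf{P}_a>0$ are the face quadrature weights. The penalty is called entropy dissipative if this contribution is non-positive point-wise. *)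

(* Defs.v *)
From HB Require Import structures.
From mathcomp Require Import all_boot all_order all_algebra.
From mathcomp Require Import reals exp.

Set Implicit Arguments.
Unset Strict Implicit.
Unset Printing Implicit Defensive.

Import Order.TTheory GRing.Theory Num.Theory.
Local Open Scope ring_scope.

Record prim (K : realType) := Prim {
  rho : K;
  vel1 : K;
  vel2 : K;
  vel3 : K;
  temp : K }.

Definition admissible (K : realType) (v : prim K) : Prop :=
  0 < rho v /\ 0 < temp v.

(* The wall x1 = 0 has velocity (0, u2w, u3w). *)
Definition wall_state (K : realType) (u2w u3w : K) (v : prim K) : prim K :=
  Prim (rho v) (- vel1 v) (- vel2 v + 2 * u2w) (- vel3 v + 2 * u3w) (temp v).

(* The field is called K because R is the gas constant, written Rg below. *)
Record gas (K : realType) := Gas {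
  Rg : K;
  cP : K;
  rho_inf : K;
  temp_inf : K;
  mu : K -> K;
  kappa : K -> K }.

Definition gas_ok (K : realType) (g : gas K) : Prop :=
  [/\ 0 < Rg g, Rg g < cP g, 0 < rho_inf g & 0 < temp_inf g] /\
  (forall T : K, 0 < T -> 0 < mu g T /\ 0 < kappa g T).

Definition gamma (K : realType) (g : gas K) : K := cP g / (cP g - Rg g).

Definition specific_entropy (K : realType) (g : gas K) (v : prim K) : K :=
  Rg g / (gamma g - 1) * ln (temp v / temp_inf g)
  - Rg g * ln (rho v / rho_inf g).

Definition entropy_vars (K : realType) (g : gas K) (v : prim K) : 'cV[K]_5 :=
  \col_(i < 5) [:: cP g - specific_entropy g v
                   - (vel1 v ^+ 2 + vel2 v ^+ 2 + vel3 v ^+ 2) / (2 * temp v);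
                   vel1 v / temp v;
                   vel2 v / temp v;
                   vel3 v / temp v;
                   - (temp v)^-1]`_i.

Definition C11 (K : realType) (g : gas K) (v : prim K) : 'M[K]_5 :=
  let T := temp v in
  let Tm := T * mu g T in
  \matrix_(i < 5, j < 5)
    (nth [::]
      [:: [:: 0; 0; 0; 0; 0];
          [:: 0; 4 / 3 * Tm; 0; 0; 4 / 3 * Tm * vel1 v];
          [:: 0; 0; Tm; 0; Tm * vel2 v];
          [:: 0; 0; 0; Tm; Tm * vel3 v];
          [:: 0; 4 / 3 * Tm * vel1 v; Tm * vel2 v; Tm * vel3 v;
              T ^+ 2 * kappa g T
              + 1 / 3 * Tm * (4 * vel1 v ^+ 2 + 3 * vel2 v ^+ 2
                              + 3 * vel3 v ^+ 2)]] i)`_j.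

Definition penalty_coef (K : realType) (g : gas K) (beta : K)
    (v vB : prim K) : 'M[K]_5 :=
  - beta *: (2^-1 *: (C11 g v + C11 g vB)).

Definition wall_penalty (K : realType) (g : gas K) (beta u2w u3w : K)
    (v : prim K) : 'cV[K]_5 :=
  let vB := wall_state u2w u3w v in
  penalty_coef g beta v vB *m (entropy_vars g v - entropy_vars g vB).

(* w^T M at one node *)
Definition pointwise_contribution (K : realType) (w M : 'cV[K]_5) : K :=
  (w^T *m M) 0 0.

(* A penalty M on the conserved variables at the wall nodes contributes
   \sum_a P a * w_a^T M_a to the time derivative of the discretely integrated
   entropy -rho * s; it is dissipative when every summand is nonpositive. *)
Definition entropy_dissipative (K : realType) (N : finType) (P : N -> K)
    (w M : N -> 'cV[K]_5) : Prop :=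
  forall a : N, P a * pointwise_contribution (w a) (M a) <= 0.

(* Main.v *)
Require Import Defs.
From HB Require Import structures.
From mathcomp Require Import all_boot all_order all_algebra.
From mathcomp Require Import reals exp.
From mathcomp Require Import ring.

(** The boundary state has the same temperature as [v], and its velocity is the
    reflection of that of [v] through the wall velocity (0, u2w, u3w).  Two
    things follow.  The jump of the entropy variables has last component 0, and
    its momentum components are (2 / T) times the velocity relative to the wall.
    Both viscous matrices have the same viscosity, because it depends on the
    temperature alone, and their coupling between momentum and energy is linear
    in the velocity; averaging them replaces the velocity in that coupling by
    the wall velocity.  In the quadratic form the energy component -1 / T of w
    therefore subtracts (wall velocity) / T from the momentum components U / T,
    and both arguments become multiples of the velocity relative to the wall:

      w^T M = - (2 beta mu / T) (4/3 U1^2 + (U2 - u2w)^2 + (U3 - u3w)^2).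

    This identity is [wall_contributionE]; the sign of the penalty is read off
    from it. *)

Set Implicit Arguments.
Unset Strict Implicit.
Unset Printing Implicit Defensive.

Import Order.TTheory GRing.Theory Num.Theory.
Local Open Scope ring_scope.

(** The form only needs to be known against vectors [d] with vanishing last
    component, as for the jump at an isothermal reflection: the energy diagonal
    entry of the viscous matrix, the only one that contains the conductivity and
    is quadratic in the velocity, then drops out. *)
Lemma C11_form (K : realType) (g : gas K) (v : prim K) (w d : 'cV[K]_5)
  (hd : d (inord 4) 0 = 0) :
  (w^T *m C11 g v *m d) 0 0 =
  temp v * mu g (temp v) *
    (4 / 3 * (w (inord 1) 0 + vel1 v * w (inord 4) 0) * d (inord 1) 0
     + (w (inord 2) 0 + vel2 v * w (inord 4) 0) * d (inord 2) 0
     + (w (inord 3) 0 + vel3 v * w (inord 4) 0) * d (inord 3) 0).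
Proof.
have inordE (i : 'I_5) k : i = k :> nat -> i = inord k.
  by move=> <-; rewrite inord_val.
rewrite -mulmxA !mxE !big_ord_recl big_ord0 !mxE !big_ord_recl !big_ord0 !mxE /=.
rewrite (inordE (lift ord0 ord0) 1%N) //.
rewrite (inordE (lift ord0 (lift ord0 ord0)) 2%N) //.
rewrite (inordE (lift ord0 (lift ord0 (lift ord0 ord0))) 3%N) //.
rewrite (inordE (lift ord0 (lift ord0 (lift ord0 (lift ord0 ord0)))) 4%N) // hd.
by field.
Qed.

Lemma wall_contributionE (K : realType) (g : gas K) (beta u2w u3w : K)
  (v : prim K) (hT : temp v != 0) :
  pointwise_contribution (entropy_vars g v) (wall_penalty g beta u2w u3w v) =
  - (2 * beta * mu g (temp v) / temp v *
     (4 / 3 * vel1 v ^+ 2 + (vel2 v - u2w) ^+ 2 + (vel3 v - u3w) ^+ 2)).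
Proof.
rewrite /pointwise_contribution /wall_penalty /penalty_coef.
set w := entropy_vars g v; set vB := wall_state u2w u3w v.
set d := w - entropy_vars g vB.
have hd : d (inord 4) 0 = 0 by rewrite !mxE !inordK //= subrr.
rewrite mulmxA -!scalemxAr -!scalemxAl [w^T *m _]mulmxDr mulmxDl.
rewrite 2![in LHS]mxE [in LHS]mxE !C11_form // !mxE !inordK //=.
by field.
Qed.

Theorem theorem3p3 (K : realType) (g : gas K) (hg : gas_ok g)
  (N : finType) (P : N -> K) (hP : forall a : N, 0 < P a)
  (v : N -> prim K) (hv : forall a : N, admissible (v a))
  (u2wall u3wall : N -> K) (beta : K) (hbeta : 0 < beta) :
  entropy_dissipative P
    (fun a : N => entropy_vars g (v a))
    (fun a : N => wall_penalty g beta (u2wall a) (u3wall a) (v a))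
  /\ (forall a : N,
        pointwise_contribution (entropy_vars g (v a))
          (wall_penalty g beta (u2wall a) (u3wall a) (v a)) <= 0).
Proof.
have pointwise a : pointwise_contribution (entropy_vars g (v a))
    (wall_penalty g beta (u2wall a) (u3wall a) (v a)) <= 0.
  have [_ T_gt0] := hv a; have [mu_gt0 _] := hg.2 _ T_gt0.
  rewrite wall_contributionE ?gt_eqF // oppr_le0 mulr_ge0 //.
    by rewrite divr_ge0 ?mulr_ge0 // ltW.
  by rewrite !addr_ge0 ?sqr_ge0 // mulr_ge0 ?sqr_ge0 // divr_ge0.
split=> // a.
by rewrite pmulr_rle0.
Qed.
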